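(* Let $N$ be a nonempty set, $\mathcal{B}\subseteq 2^N$ a Boolean algebra of subsets of $N$, and $X$ a (finite or infinite) set with $\#X\ge 2$. Let $\mathcal{W}\subseteq\mathcal{B}$ be a simple game and $B\subseteq X$ an agenda. Let $\mathcal{M}(B)^N_{\mathcal{B}}$ be the set of $\mathcal{B}$-measurable profiles of preferences on $X$ each having a maximal element of $B$. Then the following statements are equivalent: (i) $\#B<\nu(\mathcal{W})$, where $\nu(\mathcal{W})$ is the Nakamura number of $\mathcal{W}$; (ii) the core without majority dissatisfaction $C^+(\mathcal{W},B,\mathbf{p})$ is nonempty for all $\mathbf{p}\in\mathcal{M}(B)^N_{\mathcal{B}}$; (iii) the core $C(\mathcal{W},B,\mathbf{p})$ is nonempty for all $\mathbf{p}\in\mathcal{M}(B)^N_{\mathcal{B}}$.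
   Context: $N$ is the set of players; elements of the Boolean algebra $\mathcal{B}$ (which contains $N$ and is closed under finite unions, finite intersections and complements) are called coalitions. A ($\mathcal{B}$-)simple game is a collection $\mathcal{W}\subseteq\mathcal{B}$ with $\emptyset\notin\mathcal{W}$ and $\mathcal{W}\ne\emptyset$; its elements are winning. No monotonicity or properness is assumed. $\#Y$ denotes the cardinal number of $Y$. A preference is an asymmetric binary relation $\succ$ on $X$ ($x\succ y$ implies not $y\succ x$). A profile is a family $\mathbf{p}=(\succ_i^{\mathbf{p}})_{i\in N}$ of preferences; it is ($\mathcal{B}$-)measurable if $\{i: x\succ_i^{\mathbf{p}}y\}\in\mathcal{B}$ for all $x,y\in X$. An agenda is a subset $B\subseteq X$. An element $x\in B$ is a maximal element of $B$ with respect to $\succ$, written $x\in\max_B\succ$, if there is no $y\in B$ with $y\succ x$. Core: $C(\mathcal{W},B,\mathbf{p})$ is the set of $x\in B$ such that there are no $y\in B$ and $S\in\mathcal{W}$ with $y\succ_i^{\mathbf{p}}x$ for all $i\in S$. Core without majority dissatisfaction: $C^+(\mathcal{W},B,\mathbf{p})$ is the set of $x\in B$ such that there is no $S\in\mathcal{W}$ with $S\subseteq\{i: x\notin\max_B\succ_i^{\mathbf{p}}\}$ (i.e., no $S\in\mathcal{W}$ such that every $i\in S$ has some $y_i\in B$ with $y_i\succ_i^{\mathbf{p}}x$). Nakamura number: $\nu(\mathcal{W})=\min\{\#\mathcal{V}:\mathcal{V}\subseteq\mathcal{W},\ \bigcap\mathcal{V}=\emptyset\}$ if $\bigcap\mathcal{W}=\emptyset$;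 otherwise $\nu(\mathcal{W})=+\infty$, understood to be greater than any cardinal number. (The intersection of the empty collection is $N$.) *)

(* Defs.v *)
From mathcomp Require Import all_boot all_order all_classical.

Set Implicit Arguments.
Unset Strict Implicit.
Unset Printing Implicit Defensive.

Local Open Scope classical_set_scope.

(* A cardinal number is represented by any set having that cardinality, and
   compared through [xcard_lt], never through Leibniz equality.  [CardOo] is
   the formal value exceeding every cardinal number, infinite ones included. *)
Inductive xcard : Type :=
| Card (T : Type) (A : set T)
| CardOo.

Definition xcard_lt (a b : xcard) : Prop :=
  match a, b with
  | Card _ A, Card _ B => (A #<= B)%card /\ ~ (B #<= A)%card
  | Card _ _, CardOo => True
  | CardOo, _ => False
  end.

(* [least_card F] is a member of [F] of least cardinality if [F] is nonempty;
   [least_cardP] shows that such a member exists. *)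
Definition least_card (T : Type) (F : set (set T)) : set T :=
  xget set0 [set A | F A /\ forall A', F A' -> (A #<= A')%card].

Lemma least_card_ex (T : Type) (F : set (set T)) :
  F !=set0 -> exists A, F A /\ forall A', F A' -> (A #<= A')%card.
Proof.
move=> [A0 FA0].
pose I := {A : set T | F A}.
pose P (S : set (I -> T)) :=
  (forall x, S x -> forall i, sval i (x i)) /\
  (forall i x y, S x -> S y -> x i = y i -> x = y).
have [|S [[SF Sinj] Smax]] := @Zorn_bigcup (I -> T) P.
  move=> G GP Gtot; split=> [x [S GS Sx] i|i x y [S GS Sx] [S' GS' S'y]].
    by have [+ _] := GP _ GS; exact.
  have [SS'|S'S] := Gtot _ _ GS GS'.
    by have [_ +] := GP _ GS'; apply => //; exact: SS'.
  by have [_ +] := GP _ GS; apply => //; exact: S'S.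
have [[i Si]|noi] := pselect (exists i, sval i `<=` (fun x => x i) @` S).
  exists (sval i); split; first exact: svalP.
  move=> A FA; pose j : I := exist _ A FA.
  apply: (card_le_trans (subset_card_le Si)).
  apply: (card_le_trans (card_image_le _ _)).
  have Sj : {in S &, injective (fun x : I -> T => x j)}.
    by move=> x y; rewrite !inE; exact: Sinj.
  rewrite -(card_le_eql (inj_card_eq Sj)).
  apply: subset_card_le => _ [x Sx <-]; exact: (SF x Sx j).
have /choice[x xP] : forall i, exists t, sval i t /\ ~ ((fun x => x i) @` S) t.
  move=> i; apply: contrapT => H; apply: noi; exists i => t it.
  by apply: contrapT => St; apply: H; exists t.
exfalso; apply: (Smax (S `|` [set x])).
  split; first by move=> y; left.
  move=> /(_ x (or_intror erefl)) Sx.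
  by have [_] := xP (exist _ A0 FA0); apply; exists x.
split=> [y [|->] i|i y z [Sy|->] [Sz|->] //].
- by move=> Sy; exact: SF.
- by have [] := xP i.
- exact: Sinj.
- by move=> yx; have [_] := xP i; case; exists y.
- by move=> xz; have [_] := xP i; case; exists z.
Qed.

Lemma least_cardP (T : Type) (F : set (set T)) : F !=set0 ->
  F (least_card F) /\ forall A, F A -> (least_card F #<= A)%card.
Proof. by move=> /least_card_ex; exact: xgetPex. Qed.

Section simple_games.
Variables (N X : Type).

Definition boolean_algebra (BB : set (set N)) : Prop :=
  [/\ BB setT, setU_closed BB, setI_closed BB & forall S, BB S -> BB (~` S)].

Definition simple_game (BB W : set (set N)) : Prop :=
  [/\ W `<=` BB, ~ W set0 & W !=set0].

Definition preference (r : X -> X -> Prop) : Prop :=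
  forall x y, r x y -> ~ r y x.

(* [p i x y] reads: player [i] strictly prefers [x] to [y]. *)
Definition profile : Type := N -> X -> X -> Prop.

Definition measurable_profile (BB : set (set N)) (p : profile) : Prop :=
  forall x y, BB [set i | p i x y].

Definition maximal_elements (B : set X) (r : X -> X -> Prop) : set X :=
  [set x | B x /\ ~ exists y, B y /\ r y x].

Definition profiles_with_maximal (BB : set (set N)) (B : set X) : set profile :=
  [set p | [/\ forall i, preference (p i),
               measurable_profile BB p
             & forall i, maximal_elements B (p i) !=set0]].

Definition core (W : set (set N)) (B : set X) (p : profile) : set X :=
  [set x | B x /\
    ~ exists y S, [/\ B y, W S & forall i, S i -> p i y x]].

Definition core_plus (W : set (set N)) (B : set X) (p : profile) : set X :=
  [set x | B x /\
    ~ exists S, W S /\ S `<=` [set i | ~ maximal_elements B (p i) x]].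

(* In the first case the family is nonempty, as it contains [W], so the minimum
   is attained by [least_cardP]. *)
Definition nakamura_number (W : set (set N)) : xcard :=
  if `[< \bigcap_(S in W) S = set0 >]
  then Card (least_card [set V | V `<=` W /\ \bigcap_(S in V) S = set0])
  else CardOo.

End simple_games.

(* Main.v *)
Require Import Defs.
From mathcomp Require Import all_boot all_order all_classical.

Set Implicit Arguments.
Unset Strict Implicit.

Local Open Scope classical_set_scope.

(** A cardinal below the Nakamura number means that no family of winning
    coalitions indexed by [B] has empty intersection.  If [core_plus] is empty,
    choose for each [x] in [B] a winning coalition of players for whom [x] is not
    maximal; since every player has a maximal element in [B], this family has
    empty intersection.  Conversely, from winning coalitions [S x] ([x] in [B])
    with empty intersection, take a self-map [f] of [B] without fixed points such
    that [x] and [y] can be exchanged by [f] only if [B = {x, y}], and let the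
    members of [S x] prefer [f x] to [x], with no other preferences.  Then no [x]
    is in the core, and [x] is maximal for every player outside [S x]. *)

(** Copies of both sets live in [T + U], where [least_card_ex] selects one that is at most the
    other. *)
Lemma card_le_total (T U : Type) (A : set T) (B : set U) :
  (A #<= B)%card \/ (B #<= A)%card.
Proof.
have Al : ((inl @` A : set (T + U)) #= A)%card by apply: inj_card_eq => x y _ _ [].
have Br : ((inr @` B : set (T + U)) #= B)%card by apply: inj_card_eq => x y _ _ [].
have [M [MAB Mle]] := @least_card_ex _ [set inl @` A; inr @` B]
  (ex_intro _ (inl @` A) (or_introl erefl)).
rewrite -(card_le_eql Al) -(card_le_eqr Br) -(card_le_eql Br) -(card_le_eqr Al).
by case: MAB => <-; [left | right]; apply: Mle; [right | left].
Qed.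

Lemma lt_nakamura_number (N X : Type) (W : set (set N)) (B : set X) :
  xcard_lt (Card B) (nakamura_number W) <->
  forall V, V `<=` W -> \bigcap_(S in V) S = set0 -> ~ (V #<= B)%card.
Proof.
rewrite /nakamura_number; case: asboolP => [W0|W0] /=.
  set F := [set V | _ /\ _].
  have [[LW L0] Lle] : F (least_card F) /\
      forall V, F V -> (least_card F #<= V)%card.
    by apply: least_cardP; exists W; split.
  split=> [[_ LB] V VW V0 VB|noV].
    by apply: LB; apply: card_le_trans VB; exact: Lle.
  by have LB := noV _ LW L0; have [|] := card_le_total (least_card F) B.
(* A player common to all of [W] belongs to every member of [V], whatever the size of [V]. *)
split=> // _ V VW V0 _; apply: W0; rewrite -subset0 -V0 => i iW S VS.
exact: iW (VW _ VS).
Qed.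

Lemma lt_nakamura_number_family (N X : Type) (W : set (set N)) (B : set X) :
  [set: N] !=set0 ->
  xcard_lt (Card B) (nakamura_number W) <->
  (B !=set0 -> forall S : X -> set N, (forall x, B x -> W (S x)) ->
   \bigcap_(x in B) S x !=set0).
Proof.
move=> [i0 _]; rewrite lt_nakamura_number; split=> [noV _ S SW|nofam V VW V0 VB].
  apply/set0P/eqP => S0.
  apply: (noV (S @` B)); last exact: card_image_le.
    by move=> _ [x Bx <-]; exact: SW.
  by rewrite bigcap_image.
(* Either [V] is an image of [B], or it is empty and its intersection [N] contains [i0]. *)
have [V00|/surjfunPex[S VE]] := pfcard_geP VB.
  by have : set0 i0 by rewrite -V0 V00 bigcap_set0.
have B0 : B !=set0.
  apply/set0P/eqP => B0.
  by have : set0 i0 by rewrite -V0 VE B0 image_set0 bigcap_set0.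
have [x Bx|i iS] := nofam B0 S.
  by apply: VW; rewrite VE; exists x.
have : set0 i by rewrite -V0 VE bigcap_image.
by [].
Qed.

Lemma core_plus_sub_core (N X : Type) (W : set (set N)) (B : set X)
    (p : profile N X) : core_plus W B p `<=` core W B p.
Proof.
move=> x [Bx noS]; split=> // -[y [S [By WS Sp]]]; apply: noS.
by exists S; split=> // i Si [_]; apply; exists y; split=> //; exact: Sp.
Qed.

Lemma core_plus_nonempty (N X : Type) (W : set (set N)) (B : set X)
    (p : profile N X) :
  (forall S : X -> set N, (forall x, B x -> W (S x)) ->
   \bigcap_(x in B) S x !=set0) ->
  (forall i, maximal_elements B (p i) !=set0) ->
  core_plus W B p !=set0.
Proof.
move=> nofam pmax; apply: contrapT => core0.
have /choice[S SP] : forall x, exists S : set N,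
    B x -> W S /\ S `<=` [set i | ~ maximal_elements B (p i) x].
  (* Outside [B], [set0] is a dummy value. *)
  move=> x; have [Bx|] := pselect (B x); last by exists set0.
  apply: contrapT => noS; apply: core0; exists x; split=> // -[S WS].
  by apply: noS; exists S.
have [x Bx|i iS] := nofam S; first by have [] := SP x Bx.
have [x xmax] := pmax i; have Bx := xmax.1.
by have [_ /(_ i (iS x Bx))] := SP x Bx; apply.
Qed.

Lemma fixedfree_map_exchange (X : Type) (B : set X) (a b : X) :
  B a -> B b -> a <> b ->
  exists f : X -> X, [/\ forall x, B x -> B (f x), forall x, f x <> x
    & forall x y, f x = y -> f y = x -> B `<=` [set x; y]].
Proof.
move=> Ba Bb ab.
(* [c] is a third element of [B], or [a] if there is none; [f] is the cycle
   a -> b -> c -> a, and every other point goes to [a]. *)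
have [c [Bc bc cP]] : exists c, [/\ B c, c <> b & c = a -> B `<=` [set a; b]].
  have [[c [Bc ca cb]]|noc] := pselect (exists c, [/\ B c, c <> a & c <> b]).
    by exists c.
  exists a; split=> // _ x Bx; apply: contrapT => /not_orP[xa xb].
  by apply: noc; exists x.
exists (fun x => if `[< x = a >] then b else if `[< x = b >] then c else a).
split=> [x _|x|x y].
- by case: (asboolP (x = a)) => xa //; case: (asboolP (x = b)).
- case: (asboolP (x = a)) => [->|xa]; first exact/nesym.
  by case: (asboolP (x = b)) => [->|_] //; exact/nesym.
(* A proper 3-cycle exchanges no two points, and points off it map into it; only [c = a] yields an
   exchange, that of [a] and [b]. *)
case: (asboolP (x = a)) => [->|xa].
  move=> <-; case: (asboolP (b = a)) => [/esym//|_].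
  by case: (asboolP (b = b)) => // _; exact: cP.
case: (asboolP (x = b)) => [->|xb] <-.
  case: (asboolP (c = a)) => [ca _|ca].
    by rewrite setUC ca; exact: cP.
  by case: (asboolP (c = b)) => // _ /ab.
by case: (asboolP (a = a)) => // _ /esym.
Qed.

Lemma exists_empty_core (N X : Type) (BB : set (set N)) (W : set (set N))
    (B : set X) (S : X -> set N) :
  boolean_algebra BB -> simple_game BB W -> B !=set0 ->
  (forall x, B x -> W (S x)) -> \bigcap_(x in B) S x = set0 ->
  exists2 p : profile N X, profiles_with_maximal BB B p & core W B p = set0.
Proof.
move=> [BBT _ _ BBC] [WB W0 _] [a Ba] SW S0.
have BB0 : BB set0 by rewrite -setCT; exact: BBC.
(* If [a] were alone in [B], the empty intersection would be the winning coalition [S a]. *)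
have [b [Bb ab]] : exists b, B b /\ a <> b.
  apply: contrapT => nob; apply: W0.
  suff -> : set0 = S a by exact: SW.
  rewrite -S0; apply/seteqP; split=> [i|i iSa x Bx]; first exact.
  have [<-//|xa] := pselect (a = x).
  by exfalso; apply: nob; exists x.
have [f [fB ffix fswap]] := fixedfree_map_exchange Ba Bb ab.
pose p : profile N X := fun i y x => [/\ B x, y = f x & S x i].
exists p.
  split=> [i x y [By xy Syi] [Bx yx Sxi]|x y|i].
  (* Asymmetry: if [f] exchanges [x] and [y], they exhaust [B], so [i] would lie in every [S z] with
     [z] in [B]. *)
  - have : set0 i.
      by rewrite -S0 => z /(fswap x y (esym yx) (esym xy))[] ->.
    by [].
  (* Measurability: the players preferring [x] to [y] form [S y] or the empty coalition. *)
  - have [[By xy]|xy] := pselect (B y /\ x = f y).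
      suff -> : [set i | p i x y] = S y by exact/WB/SW.
      by apply/seteqP; split=> [i []|i].
    suff -> : [set i | p i x y] = set0 by [].
    by rewrite -subset0 => i [By xfy _]; apply: xy.
  - have [x [Bx Sxi]] : exists x, B x /\ ~ S x i.
      apply: contrapT => nox; have : set0 i; last by [].
      by rewrite -S0 => x Bx; apply: contrapT => Sxi; apply: nox; exists x.
    by exists x; split=> // -[y [_ []]].
rewrite -subset0 => x [Bx]; apply; exists (f x), (S x).
by split=> //; [exact: fB | exact: SW].
Qed.

Theorem theorem2 (N : Type) (hN : [set: N] !=set0)
    (BB : set (set N)) (hBB : boolean_algebra BB)
    (X : Type) (hX : (`I_2 #<= [set: X])%card)
    (W : set (set N)) (hW : simple_game BB W) (B : set X) :
  [<-> xcard_lt (Card B) (nakamura_number W);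
       forall p : profile N X, profiles_with_maximal BB B p ->
         core_plus W B p !=set0;
       forall p : profile N X, profiles_with_maximal BB B p ->
         core W B p !=set0].
Proof.
tfae.
- move=> /(lt_nakamura_number_family _ _ hN) nofam p [_ _ pmax].
  have [i0 _] := hN; have [x [Bx _]] := pmax i0.
  have B0 : B !=set0 by exists x.
  by apply: core_plus_nonempty => //; exact: nofam.
- by move=> h p /h[x xcore]; exists x; exact: core_plus_sub_core.
- move=> h; apply/(lt_nakamura_number_family _ _ hN) => B0 S SW.
  apply/set0P/eqP => S0.
  have [p /h[x]] := exists_empty_core hBB hW B0 SW S0.
  by move=> + core0; rewrite core0.
Qed.
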